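(* There is an absolute constant $K$ such that for every integer $n\ge 3$, the nondeterministic communication complexity of the boolean function $f_{P_n}$ associated with the spanning tree polytope $P_n$ (of the complete graph on $n$ nodes) is at most $$2\log_2 n+\log_2\log_2 n+K.$$
   Context: Write $[n]=\{1,\dots,n\}$ and let $\binom{[n]}{2}$ be the set of 2-element subsets of $[n]$. The spanning tree polytope $P_n\subset\mathbb{R}^{\binom{[n]}{2}}$ is the convex hull of the characteristic vectors of the edge sets $T\subseteq\binom{[n]}{2}$ of trees $([n],T)$ with node set $[n]$; these vectors are exactly its vertices. For a polytope $P$ with set of facets $F(P)$ and set of vertices $V(P)$, the boolean function $f_P\colon F(P)\times V(P)\to\{0,1\}$ maps a (facet, vertex) pair to $0$ if the vertex lies on the facet, and to $1$ otherwise. Nondeterministic communication complexity: for a boolean function $f\colon X\times Y\to\{0,1\}$, Alice receives $x\in X$ and Bob receives $y\in Y$. A nondeterministic protocol consists of a finite set $\mathcal{C}$ of certificates together with rules by which, given a certificate $C\in\mathcal{C}$ sent by a Prover, Alice (knowing only $x$ and $C$) and Bob (knowing only $y$ and $C$) each accept or reject (without loss of generality Alice and Bob do not communicate with each other). It computes $f$ if (i) for every $(x,y)$ with $f(x,y)=1$ there is a $C\in\mathcal{C}$ for which both accept, and (ii) for every $(x,y)$ with $f(x,y)=0$ and every $C\in\mathcal{C}$, at least one of them rejects. The cost is $\log_2|\mathcal{C}|$, and the nondeterministic communication complexity of $f$ is the smallest cost of a protocol computing $f$. Equivalently, it is $\log_2$ of the minimum number of rectangles $K\times L$ ($K\subseteq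 X$, $L\subseteq Y$), each contained in $f^{-1}(1)$, whose union is $f^{-1}(1)$. *)

(* Defs.v *)
From HB Require Import structures.
From mathcomp Require Import all_boot all_order all_algebra.
From mathcomp Require Import all_classical all_reals all_analysis.

Set Implicit Arguments.
Unset Strict Implicit.
Unset Printing Implicit Defensive.

Import Order.TTheory GRing.Theory Num.Theory.

Local Open Scope classical_set_scope.
Local Open Scope ring_scope.

Definition log2 (R : realType) (x : R) : R := ln x / ln 2.

Section Polytopes.
Context {R : realType} {V : vectType R}.
Implicit Types (A P F S : set V) (U W : {vspace V}).

Definition conv_hull A : set V := smallest (@convex_set R V) A.

(* U is the linear subspace parallel to the affine hull of S. *)
Definition is_direction S U : Prop :=
  (forall x y, S x -> S y -> x - y \in U) /\
  (forall W, (forall x y, S x -> S y -> x - y \in W) -> (U <= W)%VS).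

(* Affine dimension; the empty set has dimension -1. *)
Definition has_dim S (d : int) : Prop :=
  (S = set0 /\ d = -1) \/
  (S !=set0 /\ exists2 U, is_direction S U & d = (\dim U)%:Z).

Definition is_face P F : Prop :=
  exists (c : {linear V -> R^o}) (b : R),
    (forall x, P x -> c x <= b) /\ F = P `&` [set x | c x = b].

Definition is_facet P F : Prop :=
  is_face P F /\ exists d : int, has_dim P d /\ has_dim F (d - 1).

Definition is_vertex P (v : V) : Prop := is_face P [set v].

Definition facet P : Type := {F : set V | is_facet P F}.
Definition vertex P : Type := {v : V | is_vertex P v}.

Definition facet_vertex_fun P (F : facet P) (v : vertex P) : bool :=
  ~~ `[< sval F (sval v) >].

End Polytopes.

Arguments facet_vertex_fun {R V} P F v.

Section Communication.
Context {X Y : Type}.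

Record nd_protocol := NDProtocol {
  certificate : finType;
  alice_accepts : X -> certificate -> bool;
  bob_accepts : Y -> certificate -> bool }.

Definition computes (p : nd_protocol) (f : X -> Y -> bool) : Prop :=
  (forall x y, f x y = true ->
     exists C : certificate p, alice_accepts x C /\ bob_accepts y C) /\
  (forall x y, f x y = false ->
     forall C : certificate p, ~~ alice_accepts x C \/ ~~ bob_accepts y C).

(* Since ln 0 = 0, an empty certificate set, which can only compute the
   constant function 0, is given cost 0. *)
Definition cost (R : realType) (p : nd_protocol) : R :=
  log2 #|certificate p|%:R.

(* The infimum is taken in the extended reals, so that it is +oo when no
   protocol computes f; otherwise it is attained. *)
Definition nd_complexity (R : realType) (f : X -> Y -> bool) : \bar R :=
  ereal_inf [set c | exists p : nd_protocol, computes p f /\ c = (cost R p)%:E].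

End Communication.

Arguments nd_protocol : clear implicits.

(* Nodes are 0, ..., n-1. *)
Definition edge (n : nat) : finType := {e : {set 'I_n} | #|e| == 2%N}.

Definition graph_adj n (T : {set edge n}) : rel 'I_n :=
  fun u v => [exists e in T, val e == [set u; v]%SET].

Definition is_connected n (T : {set edge n}) : Prop :=
  forall u v : 'I_n, connect (graph_adj T) u v.

(* Simple cycles are taken to have at least 3 nodes: a single edge gives a
   cyclic adjacency sequence of size 2. *)
Definition is_acyclic n (T : {set edge n}) : Prop :=
  forall s : seq 'I_n, (2 < size s)%N -> ~ ucycle (graph_adj T) s.

Definition is_tree n (T : {set edge n}) : Prop :=
  is_connected T /\ is_acyclic T.

Definition char_vector (R : realType) n (T : {set edge n}) :
    {ffun edge n -> R^o} :=
  [ffun e => (e \in T)%:R].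

Definition spanning_tree_polytope (R : realType) (n : nat) :
    set {ffun edge n -> R^o} :=
  conv_hull [set char_vector R T | T in [set T : {set edge n} | is_tree T]].

Arguments spanning_tree_polytope : clear implicits.

(* Main.v *)
Require Import Defs.
From mathcomp Require Import all_boot all_order all_algebra.
From mathcomp Require Import all_classical all_reals all_analysis.
From mathcomp Require Import zify.

(* By the exchange argument behind Kruskal's algorithm, a tree [T] outside a face
   [F] either contains an edge lying in no tree of [F], or is disconnected on a
   node set [U] on which every tree of [F] is connected. No description of the
   facets is needed, and [F] may be any face.
   In the first case the prover announces the edge. In the second, some node
   [v] outside [U] separates two nodes of [U] in [T]. Let [b] be a node of [U]
   whose number is nearest to that of [v], and [a] a node of [U] that [v]
   separates from [b]. If [2 ^ j <= |v - b| < 2 ^ (j + 1)], then no number at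
   distance less than [2 ^ (j + 1)] from [b] on the side of [v] belongs to [U];
   so announcing [a], [b], [j] and the side lets Alice guarantee that [v] is
   outside [U], although only Bob knows [v]. There are [n ^ 2 * O(log n)]
   announcements. *)

Set Implicit Arguments.
Unset Strict Implicit.
Unset Printing Implicit Defensive.

Import Order.TTheory GRing.Theory Num.Theory.

Local Open Scope ring_scope.

(** * Trees as connected graphs whose edges are all bridges *)

Section Trees.
(* Lets the finite-set lemmas shadow their namesakes on classical sets. *)
Import mathcomp.boot.fintype mathcomp.boot.finset.
Variable n : nat.
Implicit Types (S T : {set edge n}) (U : {set 'I_n}) (e f g : edge n).
Implicit Types (u v x y p q : 'I_n).

Definition joined S u v : bool := connect (graph_adj S) u v.

Definition induced U T : {set edge n} := [set e in T | val e \subset U]%SET.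

Definition spans U T : Prop := {in U &, forall u v, joined (induced U T) u v}.

(** Acyclicity phrased through reachability, so that exchanging edges requires no handling of
    cycles. *)
Definition bridged T : Prop :=
  forall e u v, e \in T -> val e = [set u; v]%SET -> ~~ joined (T :\ e) u v.

Lemma eq_set2P (I : finType) (a b c d : I) :
  [set a; b]%SET = [set c; d]%SET -> (a = c /\ b = d) \/ (a = d /\ b = c).
Proof.
move=> E; have := set21 a b; have := set22 a b; have := set21 c d; have := set22 c d.
rewrite -{1 2}E {3 4}E !inE.
by do 4![case/orP => /eqP ?]; subst; auto.
Qed.

Lemma edge_ends e : exists u v, u != v /\ val e = [set u; v]%SET.
Proof. exact/cards2P/(valP e). Qed.

Lemma graph_adjP S u v :
  reflect (exists2 e, e \in S & val e = [set u; v]%SET) (graph_adj S u v).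
Proof.
apply: (iffP existsP) => [[e /andP[eS /eqP ev]]|[e eS ev]]; exists e => //.
by rewrite eS; apply/eqP.
Qed.

Lemma graph_adj_sym S : symmetric (graph_adj S).
Proof. by move=> u v; rewrite /graph_adj; apply: eq_existsb => e; rewrite setUC. Qed.

Lemma joined_sym S : symmetric (joined S).
Proof. exact: sym_connect_sym (@graph_adj_sym S). Qed.

Lemma joined_trans S : transitive (joined S).
Proof. exact: connect_trans. Qed.

Lemma joined_edge S e u v : e \in S -> val e = [set u; v]%SET -> joined S u v.
Proof. by move=> eS ev; apply/connect1/graph_adjP; exists e. Qed.

Lemma joined_sub S S' :
  (forall e u v, e \in S -> val e = [set u; v]%SET -> joined S' u v) ->
  forall u v, joined S u v -> joined S' u v.
Proof.
by move=> SS'; apply: connect_sub => u v /graph_adjP[e eS ev]; apply: SS' ev.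
Qed.

Lemma joined_subset S S' u v : S \subset S' -> joined S u v -> joined S' u v.
Proof.
move=> /subsetP SS'; apply: joined_sub => e x y eS.
by apply: joined_edge; apply: SS'.
Qed.

(** Repeated crossings of [g] collapse: by induction on the walk, at most one crossing, in one of
    the two directions, has to be kept. *)
Lemma joined_setU1 S g p q x y : val g = [set p; q]%SET ->
  joined (g |: S) x y ->
  [\/ joined S x y, joined S x p /\ joined S q y
    | joined S x q /\ joined S p y].
Proof.
move=> gpq /connectP[s]; elim: s x => [|z s IH] x /= => [_ ->|].
  by apply: Or31; apply: connect0.
move=> /andP[/graph_adjP[e]]; rewrite !inE => /orP[/eqP->|eS] ev zs ys.
  have [[<- zq]|[<- zp]] : (p = x /\ q = z) \/ (q = x /\ p = z).
    by move: ev; rewrite gpq => /eq_set2P[][]; [left|right].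
  - rewrite -zq in zs ys; have [j|[j1 j2]|[j1 j2]] := IH _ zs ys.
    + by apply: Or32; split => //; apply: connect0.
    + by apply: Or32; split => //; apply: connect0.
    + by apply: Or31.
  - rewrite -zp in zs ys; have [j|[j1 j2]|[j1 j2]] := IH _ zs ys.
    + by apply: Or33; split => //; apply: connect0.
    + by apply: Or31.
    + by apply: Or33; split => //; apply: connect0.
have xz : joined S x z by apply: joined_edge ev.
have [j|[j1 j2]|[j1 j2]] := IH _ zs ys.
- by apply: Or31; apply: joined_trans j.
- by apply: Or32; split => //; apply: joined_trans j1.
- by apply: Or33; split => //; apply: joined_trans j1.
Qed.

(** A walk between the ends of [e] that avoids [e] can be made simple. It has at least three nodes,
    since a single step would be [e] itself, and [e] closes it to a cycle. *)
Lemma tree_bridged T : is_tree T -> bridged T.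
Proof.
move=> [_ acT] e u v eT ev; apply/negP => /connectP[s0 us0 vs0].
case: (shortenP us0) vs0 => s us uniq_s _ vs.
have uv : u != v.
  by have := valP e; rewrite /= ev cards2; case: (u != v).
case: s us uniq_s vs => [|y [|z s]] us uniq_s vs.
- by rewrite vs eqxx in uv.
- move: us vs => /=; rewrite andbT => + yv; rewrite -yv => /graph_adjP[e']; rewrite !inE -ev.
  by move=> /andP[/eqP + _] /val_inj.
apply: (acT [:: u, y, z & s]) => //; apply/andP; split=> //.
rewrite /cycle rcons_path; apply/andP; split; last first.
  by rewrite -vs; apply/graph_adjP; exists e => //; rewrite ev setUC.
apply: sub_path us => a b /graph_adjP[e']; rewrite !inE => /andP[_ e'T] e'v.
by apply/graph_adjP; exists e'.
Qed.

(** On a cycle, the first edge is bypassed by the rest of the cycle, so it is no bridge. *)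
Lemma bridged_tree T : is_connected T -> bridged T -> is_tree T.
Proof.
move=> conT brT; split=> // -[|x [|y [|z s]]] // _ /andP[xs uniq_s].
move: xs => /= /and3P[/graph_adjP[e eT ev] yz zs].
have /negP := brT e x y eT ev; apply.
move: uniq_s; rewrite /= !inE !negb_or.
move=> /and3P[/and3P[xy xz xs] /andP[yz' ys] /andP[_ _]].
(* A step that misses one end of [e] cannot use [e], and the nodes of the cycle are distinct. *)
have stay a b : (y \notin [:: a; b]) || (x \notin [:: a; b]) ->
    graph_adj T a b -> graph_adj (T :\ e) a b.
  move=> ab /graph_adjP[e' e'T e'v]; apply/graph_adjP; exists e' => //.
  rewrite !inE e'T andbT; apply/eqP => e'e; move: e'v; rewrite e'e ev.
  by move=> /eq_set2P[][E1 E2]; move: ab; rewrite !inE E1 E2 !eqxx !orbT.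
rewrite joined_sym; apply/connectP; exists (z :: rcons s x); last first.
  by rewrite /= last_rcons.
rewrite /= stay //=; last by rewrite !inE !negb_or xy xz orbT.
apply: (@sub_in_path _ [pred a | a != y]) zs; last first.
  rewrite /= eq_sym yz' all_rcons /= xy /=; apply/allP => a /= a_s.
  by apply: contraNneq ys => <-.
move=> a b /=; rewrite !inE => ay by'; apply: stay.
by rewrite !inE negb_or ![y == _]eq_sym ay by'.
Qed.

(** * Separating edges and edge exchange *)

(** Enlarge [S] to a maximal subset of [T] that still separates [a] from [b]. Adding any further
    edge [f] of [T] joins them, so if [T] without [f] also joined them, the ends of [f] would be
    joined there by way of [a] and [b]. *)
Lemma separating_edge S T a b : bridged T -> S \subset T ->
  joined T a b -> ~~ joined S a b ->
  exists2 f, f \in T :\: S & ~~ joined (T :\ f) a b.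
Proof.
move=> brT ST abT abS.
pose good (S' : {set edge n}) := (S' \subset T) && ~~ joined S' a b.
have [S' /maxsetP[/andP[S'T abS'] maxS'] SS'] : {S' | maxset good S' & S \subset S'}.
  by apply: maxset_exists; rewrite /good ST.
have [f fT fS'] : exists2 f, f \in T & f \notin S'.
  apply/subsetPn; apply: contraNN abS' => TS'.
  exact: joined_subset abT.
exists f; first by rewrite !inE fT andbT; apply: contraNN fS' => /(subsetP SS').
have [x [y [_ fxy]]] := edge_ends f.
have S'f : S' \subset T :\ f by rewrite subsetD1 S'T.
have abf : joined (f |: S') a b.
  apply: contraNT fS' => abf; rewrite -(maxS' (f |: S')%SET) ?setU11 ?subsetUr//.
  by rewrite /good abf andbT subUset sub1set fT.
have /(_ _ _ _ fT fxy) := brT; apply: contra => abTf.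
have sym := @joined_sym (T :\ f).
have [|[]|[]] := joined_setU1 fxy abf; first by rewrite (negPf abS').
- move=> /(joined_subset S'f) ax /(joined_subset S'f) yb.
  by apply: joined_trans (joined_trans abTf _); rewrite sym.
- move=> /(joined_subset S'f) ay /(joined_subset S'f) xb.
  by rewrite sym; apply: joined_trans (joined_trans abTf _); rewrite sym.
Qed.

Lemma tree_exchange T f g p q : is_tree T -> f \in T ->
  val g = [set p; q]%SET -> ~~ joined (T :\ f) p q ->
  is_tree (g |: (T :\ f)).
Proof.
move=> treeT fT gpq npq; have [conT _] := treeT; have brT := tree_bridged treeT.
have [x [y [_ fxy]]] := edge_ends f.
have sub : T :\ f \subset g |: (T :\ f) by apply: subsetUr.
have symD := @joined_sym (T :\ f).
have xy : joined (g |: (T :\ f)) x y.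
  have sym := @joined_sym (g |: (T :\ f)).
  have gj : joined (g |: (T :\ f)) p q by apply: joined_edge gpq; apply: setU11.
  have : joined (f |: (T :\ f)) p q by rewrite setD1K //; apply: conT.
  move=> /(joined_setU1 fxy)[|[]|[]]; first by rewrite (negPf npq).
  - move=> /(joined_subset sub) px /(joined_subset sub) yq.
    by apply: joined_trans (joined_trans gj _); rewrite sym.
  - move=> /(joined_subset sub) py /(joined_subset sub) xq.
    by rewrite sym; apply: joined_trans (joined_trans gj _); rewrite sym.
apply: bridged_tree => [u v|h u v].
  apply: joined_sub (conT u v) => e a b eT eab.
  have [ef|ef] := eqVneq e f; last by apply: joined_edge eab; rewrite !inE ef eT orbT.
  by move: eab; rewrite ef fxy => /eq_set2P[][<- <-]//; rewrite joined_sym.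
have gT : g \notin T :\ f by apply: contra npq => gT; apply: joined_edge gpq.
rewrite in_setU1 => /orP[/eqP->|hT].
  rewrite gpq setU1K // => /eq_set2P[][<- <-]//.
  by rewrite symD.
(* A walk between the ends of [h] in the new graph without [h] either avoids [g], against [h] being
   a bridge of [T], or crosses [g]; in that case its two remaining pieces and [h] join [p] to [q]
   without [f]. *)
move=> huv; apply/negP.
have hg : h != g by apply: contraNneq gT => <-.
have -> : (g |: (T :\ f)) :\ h = g |: (T :\ f :\ h).
  by rewrite setDUl; congr (_ :|: _); apply/setDidPl; rewrite disjoints1 inE eq_sym.
have sh : T :\ f :\ h \subset T :\ f by apply: subD1set.
have hj : joined (T :\ f) u v by apply: joined_edge huv.
move=> /(joined_setU1 gpq)[|[]|[]].
- have hT' : h \in T by move: hT; rewrite !inE => /andP[].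
  move=> /(@joined_subset _ (T :\ h)) j; have /negP := brT _ _ _ hT' huv; apply; apply: j.
  by rewrite setSD // subD1set.
- move=> /(joined_subset sh) up /(joined_subset sh) qv; move/negP: npq; apply.
  by apply: (joined_trans (y := u)); [rewrite symD|apply: joined_trans hj _; rewrite symD].
- move=> /(joined_subset sh) uq /(joined_subset sh) pv; move/negP: npq; apply.
  by apply: (joined_trans pv); apply: (joined_trans (y := u)); rewrite // symD.
Qed.

Lemma tree_subset_eq T T' : is_tree T -> is_tree T' -> T' \subset T -> T' = T.
Proof.
move=> /tree_bridged brT [conT' _] T'T; apply/eqP; rewrite eqEsubset T'T /=.
apply/subsetP => g gT; have [p [q [_ gpq]]] := edge_ends g.
apply: contraNT (brT _ _ _ gT gpq) => gT'; apply: joined_subset (conT' p q).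
by rewrite subsetD1 T'T.
Qed.

(** * Separating nodes and gaps in the numbering *)

(** Some edge of [T] not contained in [U] separates [a] from [b]; removing an end of it outside [U]
    removes that edge. *)
Lemma separating_vertex U T a b : is_tree T -> ~~ joined (induced U T) a b ->
  exists2 v, v \notin U & ~~ joined (induced [set~ v] T) a b.
Proof.
move=> treeT nab; have [conT _] := treeT.
have [|f] := separating_edge (tree_bridged treeT) _ (conT a b) nab.
  by rewrite ?/induced setIdE subsetIl.
rewrite !inE negb_and => /andP[/orP[/negP//|/subsetPn[v vf vU]] fT] nabf.
exists v => //; apply: contra nabf; apply: joined_subset.
apply/subsetP => e; rewrite !inE => /andP[eT /subsetP ev]; rewrite eT andbT.
by apply: contraTneq vf => <-; apply/negP => /ev; rewrite !inE eqxx.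
Qed.

Definition gap (b : 'I_n) (j : nat) (up : bool) : {set 'I_n} :=
  [set x : 'I_n | if up then b < x < b + 2 ^ j.+1 else x < b < x + 2 ^ j.+1]%N.

Lemma disconnected_witness U T : is_tree T -> ~ spans U T ->
  exists a b v (j : nat) up, [/\ a \in U, b \in U, (j <= trunc_log 2 n)%N,
    v \in gap b j up /\ [disjoint gap b j up & U]
    & ~~ joined (induced [set~ v] T) a b].
Proof.
move=> treeT nspan.
have [a [a' [aU a'U naa']]] :
    exists a a', [/\ a \in U, a' \in U & ~~ joined (induced U T) a a'].
  apply: contrapT => H; apply: nspan => u v uU vU.
  by apply: contraT => nuv; case: H; exists u, v.
have [v vU nv] := separating_vertex treeT naa'.
(* The distance between the numbers of [u] and [v]: one of the two truncated differences is zero. *)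
pose d (u : 'I_n) := (u - v + (v - u))%N.
case: (arg_minnP d aU) => b bU bmin.
(* As [v] separates [a] from [a'], it separates at least one of them from [b]. *)
have [c cU ncb] : exists2 c, c \in U & ~~ joined (induced [set~ v] T) c b.
  have [ab|] := boolP (joined (induced [set~ v] T) a b); last by exists a.
  exists a' => //; apply: contra nv => a'b; apply: joined_trans ab _.
  by rewrite joined_sym.
have bv : b != v by apply: contraNneq vU => <-.
have bv' : nat_of_ord b <> v by move=> /val_inj /eqP; rewrite (negPf bv).
have d0 : (0 < d b)%N by rewrite /d; lia.
have [j [jL jd dj]] : exists j,
    [/\ j <= trunc_log 2 n, 2 ^ j <= d b & d b < 2 * 2 ^ j]%N.
  have /andP[jd dj] := trunc_log_bounds (isT : 1 < 2)%N d0.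
  exists (trunc_log 2 (d b)); rewrite -expnS; split=> //.
  by apply: leq_trunc_log; have := ltn_ord b; have := ltn_ord v; rewrite /d; lia.
exists c, b, v, j, (b < v)%N; split=> //; rewrite /d in jd dj; split.
  by rewrite inE expnS; case: (ltnP b v) => ?; lia.
(* On the side of [v], an offset from [b] strictly between 0 and [2 ^ j.+1 <= 2 * d b] puts [x]
   closer to [v] than [b] is, so [x] cannot lie in [U]. *)
apply/pred0P => x /=; apply/negP => /andP[xg /bmin]; move: xg.
by rewrite inE expnS /d; case: (ltnP b v) => ?; lia.
Qed.

(** As [U] misses the gap, [v] is outside [U], and a walk within [U] avoids it. *)
Lemma gap_separates U T a b v j up : spans U T -> a \in U -> b \in U ->
  [disjoint gap b j up & U] -> v \in gap b j up ->
  joined (induced [set~ v] T) a b.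
Proof.
move=> spanT aU bU dU vg; have vU : v \notin U by rewrite (disjointFr dU vg).
apply: joined_subset (spanT _ _ aU bU); apply/subsetP => e.
rewrite !inE => /andP[-> /subsetP eU] /=; apply/subsetP => x /eU xU.
by rewrite !inE; apply: contraNneq vU => <-.
Qed.

Lemma joined_induced S T U u v : S \subset T ->
  (forall e x y, e \in S -> val e = [set x; y]%SET -> x \in U -> y \in U) ->
  u \in U -> joined S u v -> joined (induced U T) u v.
Proof.
move=> /subsetP ST SU uU /connectP[s us ->] {v}.
elim: s u uU us => [|z s IH] u uU /=; first by move=> _; apply: connect0.
move=> /andP[/graph_adjP[e eS euz] zs]; have zU := SU _ _ _ eS euz uU.
apply: joined_trans (IH _ zU zs); apply: joined_edge (euz).
by rewrite !inE ST //= euz subUset !sub1set uU.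
Qed.

Lemma tree_edge T : (1 < n)%N -> is_tree T -> exists e, e \in T.
Proof.
move=> n1 [conT _]; apply/set0Pn; apply/negP => /eqP T0.
have /connectP[[|z s]] := conT (Ordinal (ltnW n1)) (Ordinal n1).
  by move=> _ /(congr1 val).
by move=> /= /andP[/graph_adjP[e]]; rewrite T0 inE.
Qed.

(** * Maximum-weight spanning trees *)

Section Weights.
Variables (R : realDomainType) (w : edge n -> R).

Definition weight T : R := \sum_(e in T) w e.

Lemma weight_exchange T f g : f \in T -> g \notin T :\ f ->
  weight (g |: (T :\ f)) = weight T - w f + w g.
Proof.
move=> fT gT; rewrite /weight big_setU1 //= [in RHS](big_setD1 f) //=.
by rewrite [w f + _]addrC addrK addrC.
Qed.

(** Otherwise an edge of [T] lighter than [g] separates [p] from [q], and exchanging it for [g]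
    increases the weight. *)
Lemma optimal_joined T g p q :
  is_tree T -> (forall T', is_tree T' -> weight T' <= weight T) ->
  val g = [set p; q]%SET -> joined [set e in T | w g <= w e] p q.
Proof.
move=> treeT optT gpq; have [conT _] := treeT; apply: contraT => npq.
have [|f] := separating_edge (tree_bridged treeT) _ (conT p q) npq.
  by rewrite ?/induced setIdE subsetIl.
rewrite !inE negb_and => /andP[+ fT]; rewrite fT /= -ltNge => fg npqf.
have gT : g \notin T :\ f by apply: contra npqf => gT; apply: joined_edge gpq.
have := optT _ (tree_exchange treeT fT gpq npqf).
by rewrite weight_exchange // leNgt -addrA ltrDl addrC subr_gt0 fg.
Qed.

(** Converse of [optimal_joined]. Exchanging an edge of [T'] outside [T] for a suitable edge of [T]
    loses no weight and brings [T'] closer to [T]. *)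
Lemma joined_optimal T : is_tree T ->
  (forall g p q, val g = [set p; q]%SET -> joined [set e in T | w g <= w e] p q) ->
  forall T', is_tree T' -> weight T' <= weight T.
Proof.
move=> treeT joinT T'; have [k] := ubnP #|T' :\: T|.
elim: k T' => // k IH T' T'k treeT'.
have [T'T|/subsetPn[e eT' eT]] := boolP (T' \subset T).
  by rewrite (tree_subset_eq treeT treeT' T'T).
have [a [b [_ eab]]] := edge_ends e.
have nab := tree_bridged treeT' eT' eab.
(* The edges of [T] at least as heavy as [e] join [a] to [b], so one of them must cross the cut that
   [e] leaves in [T']. *)
have [g [p [q [gT eg gpq npq]]]] : exists g p q,
    [/\ g \in T, w e <= w g, val g = [set p; q]%SET & ~~ joined (T' :\ e) p q].
  apply: contrapT => H; move/negP: nab; apply.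
  apply: joined_sub (joinT e a b eab) => g p q; rewrite !inE => /andP[gT eg] gpq.
  by apply: contraT => npq; case: H; exists g, p, q.
have gT' : g \notin T' :\ e by apply: contra npq => gT'; apply: joined_edge gpq.
apply: (le_trans _ (IH (g |: (T' :\ e)) _ (tree_exchange treeT' eT' gpq npq))).
  by rewrite weight_exchange // -addrA lerDl addrC subr_ge0.
rewrite -ltnS; apply: leq_trans T'k; rewrite ltnS; apply: proper_card.
apply/properP; split.
  apply/subsetP => h; rewrite !inE => /andP[hT /orP[/eqP hg|/andP[_ ->]]].
    by rewrite hg gT in hT.
  by rewrite hT.
exists e; rewrite !inE ?eT // eqxx orbF.
by apply: contraNneq eT => ->.
Qed.

(** By [joined_optimal], [T] fails to join the ends of some [g] by edges at least as heavy as [g].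
    Every tree of weight [m] does so for each such edge, hence connects the component [U] of [g] in
    the graph of all these edges. *)
Lemma suboptimal_tree_witness (m : R) T : (1 < n)%N -> is_tree T ->
    (forall T', is_tree T' -> weight T' <= m) -> weight T < m ->
  (exists e, e \in T /\
     forall T', is_tree T' -> weight T' = m -> e \notin T') \/
  (exists U, ~ spans U T /\
     forall T', is_tree T' -> weight T' = m -> spans U T').
Proof.
move=> n1 treeT maxm Tm; have [conT _] := treeT.
(* If no tree has weight [m], the condition on such trees is vacuous and any edge of [T] serves. *)
have [[T0 [treeT0 T0m]]|noopt] :=
  pselect (exists T0, is_tree T0 /\ weight T0 = m); last first.
  have [e eT] := tree_edge n1 treeT.
  by left; exists e; split=> // T' treeT' T'm; case: noopt; exists T'.
have [g [p [q [gpq npq]]]] : exists g p q, val g = [set p; q]%SET /\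
    ~~ joined [set e in T | w g <= w e] p q.
  apply: contrapT => H; suff : m <= weight T by rewrite leNgt Tm.
  rewrite -T0m; apply: joined_optimal treeT0 => // g p q gpq.
  by apply: contraT => npq; case: H; exists g, p, q.
pose H := [set e | w g <= w e]%SET; pose U := [set x | joined H p x]%SET.
have UH e u v : e \in H -> val e = [set u; v]%SET -> u \in U -> v \in U.
  by rewrite !inE => eH euv pu; apply: joined_trans pu (joined_edge _ euv); rewrite inE.
have HT' T' : is_tree T' -> weight T' = m ->
    {in U &, forall u v, joined [set e in T' | w g <= w e] u v}.
  move=> treeT' T'm u v; rewrite !inE => pu pv.
  have: joined H u v by apply: joined_trans pv; rewrite joined_sym.
  apply: joined_sub => e x y; rewrite inE => eH exy.
  apply: joined_subset (optimal_joined treeT' _ exy); last by rewrite T'm.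
  by apply/subsetP => f; rewrite !inE => /andP[-> /(le_trans eH)].
have spanT' T' : is_tree T' -> weight T' = m -> spans U T'.
  move=> treeT' T'm u v uU vU; apply: joined_induced (uU) (HT' _ treeT' T'm _ _ uU vU).
    by rewrite setIdE subsetIl.
  by move=> e x y; rewrite inE => /andP[_ eH]; apply: UH; rewrite inE.
have [spanT|] := pselect (spans U T); last by right; exists U.
have pU : p \in U by rewrite inE; apply: connect0.
have qU : q \in U by apply: (UH g) pU; rewrite ?gpq // inE.
(* If [T] spans [U], it must use an edge [f] lighter than [g] there. No tree of weight [m] contains
   [f], because it already joins the ends of [f] by heavier edges. *)
have [f fT fg] : exists2 f, f \in induced U T & w f < w g.
  apply: contrapT => nof; move/negP: npq; apply.
  apply: joined_subset (spanT _ _ pU qU); apply/subsetP => f fT.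
  rewrite inE; apply/andP; split; first by move: fT; rewrite inE => /andP[].
  by rewrite leNgt; apply/negP => fg; apply: nof; exists f.
move: fT; rewrite inE => /andP[fT fU].
left; exists f; split=> // T' treeT' T'm; apply/negP => fT'.
have [x [y [_ fxy]]] := edge_ends f.
have [xU yU] : x \in U /\ y \in U.
  by split; apply: (subsetP fU); rewrite fxy !inE eqxx ?orbT.
have /negP := tree_bridged treeT' fT' fxy; apply.
apply: joined_subset (HT' _ treeT' T'm _ _ xU yU); apply/subsetP => e.
rewrite !inE => /andP[-> eg]; rewrite andbT.
by apply: contraTneq eg => ->; rewrite -ltNge.
Qed.

End Weights.

End Trees.

(** * Announcements and the two acceptance rules *)

Section Protocol.
Variable n : nat.

(* [(a, b, None)] announces the edge [ab] of Bob's tree; [(a, b, Some _)]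
   announces that [a] and [b] lie in a set [U] of Alice which avoids the gap
   next to [b], and are separated in Bob's tree by a node of that gap. *)
Definition announcement : finType :=
  ('I_n * 'I_n * option ('I_(trunc_log 2 n).+1 * bool))%type.

Definition face_accepts (F : {set edge n} -> Prop) (C : announcement) : Prop :=
  let: (a, b, o) := C in
  match o with
  | None => forall T, is_tree T -> F T -> ~~ graph_adj T a b
  | Some (j, up) => exists U : {set 'I_n},
      [/\ a \in U, b \in U, [disjoint gap b j up & U]
        & forall T, is_tree T -> F T -> spans U T]
  end.

Definition tree_accepts (T : {set edge n}) (C : announcement) : Prop :=
  let: (a, b, o) := C in
  match o with
  | None => graph_adj T a b
  | Some (j, up) => exists2 v, v \in gap b j up &
      ~~ joined (induced (finset.setC [set v]%SET) T) a b
  end.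

Lemma face_accepts_sub (F F' : {set edge n} -> Prop) C :
  (forall T, F T -> F' T) -> face_accepts F' C -> face_accepts F C.
Proof.
move=> FF'; case: C => [[a b] [[j up]|]] /= => [[U [aU bU dU spanU]]|H].
  by exists U; split=> // T treeT /FF'; apply: spanU.
by move=> T treeT /FF'; apply: H.
Qed.

Lemma accepts_sound (F : {set edge n} -> Prop) T C :
  is_tree T -> F T -> face_accepts F C -> ~ tree_accepts T C.
Proof.
move=> treeT FT; case: C => [[a b] [[j up]|]] /=.
  move=> [U [aU bU dU spanU]] [v vg /negP]; apply.
  exact: gap_separates (spanU _ treeT FT) aU bU dU vg.
by move=> /(_ _ treeT FT) /negP.
Qed.

Lemma accepts_complete (R : realDomainType) (w : edge n -> R) (m : R) T :
    (1 < n)%N -> is_tree T ->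
    (forall T', is_tree T' -> weight w T' <= m) -> weight w T < m ->
  exists C, face_accepts (fun T' => weight w T' = m) C /\ tree_accepts T C.
Proof.
move=> n1 treeT maxm Tm.
have [[e [eT nF]]|[U [nspan spanU]]] := suboptimal_tree_witness n1 treeT maxm Tm.
  have [a [b [_ eab]]] := edge_ends e.
  exists (a, b, None); split=> [T' treeT' T'm|]; last by apply/graph_adjP; exists e.
  apply/graph_adjP => -[e' e'T' e'v]; have /negP := nF _ treeT' T'm; apply.
  by have -> : e = e' by apply: val_inj; rewrite eab e'v.
have [a [b [v [j [up [aU bU jL [vg dU] nab]]]]]] := disconnected_witness treeT nspan.
exists (a, b, Some (Ordinal (jL : j < (trunc_log 2 n).+1)%N, up)).
by split; [exists U|exists v].
Qed.

End Protocol.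

(** * From faces of the polytope to edge weights *)

(** If [v] were not in [A], the functional exposing [v] would be less than [b] on all of [A], hence
    on the hull, since an open half-space is convex. *)
Lemma vertex_conv_hull (R : realType) (V : vectType R) (A : set V) (v : V) :
  is_vertex (conv_hull A) v -> A v.
Proof.
move=> [c [b [cb vE]]]; apply: contrapT => nAv.
have [Pv cv] : (conv_hull A `&` [set x | c x = b])%classic v by rewrite -vE.
suff : c v < b by rewrite cv ltxx.
apply: (smallest_sub (X := [set x : V | c x < b]%classic) _ _ Pv).
  apply/convex_setW => x y; rewrite !inE /= => xb yb k k0 k1.
  have -> : conv k x y = k%:num *: (x : V) + (1 - k%:num) *: (y : V) :> V by [].
  rewrite inE /= linearD !linearZ /=.
  have -> : b = k%:num * b + (1 - k%:num) * b by rewrite -mulrDl addrC subrK mul1r.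
  by apply: ltrD; rewrite /GRing.scale /= ltr_pM2l // subr_gt0.
move=> x Ax /=; rewrite lt_neqAle cb ?andbT; last exact: sub_gen_smallest.
apply/eqP => cx; apply: nAv; suff <- : x = v by [].
have : (conv_hull A `&` [set x | c x = b])%classic x by split => //; exact: sub_gen_smallest.
by rewrite -vE.
Qed.

(** Turns a functional defining a face into an edge weighting, so that the trees on the face are
    those attaining the bound [b]. *)
Lemma linear_char_vector (R : realType) n (c : {linear {ffun edge n -> R^o} -> R^o}) T :
  c (char_vector R T) = weight (fun e => c (char_vector R [set e]%SET) : R) T.
Proof.
rewrite /weight -[RHS]linear_sum; congr (c _).
apply/ffunP => e; rewrite sum_ffunE ffunE.
have [eT|eT] := boolP (e \in T).
  rewrite (big_setD1 e) //= ffunE inE eqxx big1 ?addr0 // => f.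
  by rewrite !inE ffunE inE eq_sym => /andP[/negPf ->].
rewrite big1 // => f fT; rewrite ffunE inE.
by case: eqP fT eT => // -> ->.
Qed.

(** * The protocol for the polytope and its cost *)

Section Cost.
Variable R : realType.

(** Bob holds a vector, so his rule quantifies over the tree behind it; [vertex_conv_hull] provides
    one. *)
Definition face_protocol n : nd_protocol (facet (spanning_tree_polytope R n))
    (vertex (spanning_tree_polytope R n)) :=
  @NDProtocol _ _ (announcement n)
    (fun F C => `[< face_accepts (fun T => sval F (char_vector R T)) C >])
    (fun v C => `[< exists T,
       [/\ is_tree T, sval v = char_vector R T & tree_accepts T C] >]).

Lemma face_protocol_computes n : (1 < n)%N ->
  computes (face_protocol n) (facet_vertex_fun (spanning_tree_polytope R n)).
Proof.
move=> n1; split=> [[F [faceF dimF]] [v vertex_v]|F v] /=; last first.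
  move=> /negbFE/asboolP Fv C.
  have [|_] := boolP `[< _ >]; [move=> /asboolP FC; right|by left].
  apply/asboolPn => -[T [treeT vT TC]]; rewrite vT in Fv.
  exact: accepts_sound treeT Fv FC TC.
rewrite /facet_vertex_fun /= => /asboolPn Fv.
have [T treeT vT] := vertex_conv_hull vertex_v.
have [c [b [cb FE]]] := faceF.
have PT T' : is_tree T' -> spanning_tree_polytope R n (char_vector R T').
  by move=> treeT'; apply: sub_gen_smallest; exists T'.
have [||C [FC TC]] :=
  @accepts_complete n R (fun e => c (char_vector R [set e]%SET)) b T n1 treeT.
- by move=> T' treeT'; rewrite -linear_char_vector; apply: cb; apply: PT.
- rewrite -linear_char_vector lt_neqAle cb ?andbT; last exact: PT.
  by apply/eqP => cT; apply: Fv; rewrite FE -vT; split=> //; apply: PT.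
exists C; split; apply/asboolP; last by exists T; rewrite vT.
apply: face_accepts_sub FC => T'; rewrite /= FE => -[_ <-].
by rewrite linear_char_vector.
Qed.

Lemma card_announcement n : (#|announcement n| = n * n * ((trunc_log 2 n).+1 * 2).+1)%N.
Proof. by rewrite !card_prod card_option card_prod !card_ord card_bool. Qed.

Let ln2_gt0 : 0 < ln 2 :> R.
Proof. by rewrite ln_gt0 // ltr1n. Qed.

Lemma log2M (x y : R) : 0 < x -> 0 < y -> log2 (x * y) = log2 x + log2 y.
Proof. by move=> x0 y0; rewrite /log2 lnM ?posrE // mulrDl. Qed.

Lemma le_log2 (x y : R) : 0 < x -> x <= y -> log2 x <= log2 y.
Proof.
move=> x0 xy; rewrite /log2 ler_pM2r ?invr_gt0 // ler_ln ?posrE //.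
exact: lt_le_trans xy.
Qed.

Lemma trunc_log_le_log2 n : (0 < n)%N -> (trunc_log 2 n)%:R <= log2 (n%:R : R).
Proof.
move=> n0; rewrite /log2 ler_pdivlMr // mulr_natl -lnXn //.
rewrite ler_ln ?posrE ?exprn_gt0 ?ltr0n //.
by rewrite -natrX ler_nat trunc_logP.
Qed.

Lemma face_protocol_cost n : (1 < n)%N ->
  cost R (face_protocol n) <=
  2 * log2 (n%:R : R) + log2 (log2 (n%:R : R)) + log2 5.
Proof.
move=> n2; have n0 : (0 < n)%N by apply: ltnW.
have nR : 0 < n%:R :> R by rewrite ltr0n.
have L1 : (1 <= trunc_log 2 n)%N by rewrite trunc_log_gt0.
have Ln := trunc_log_le_log2 n0.
have lg0 : 0 < log2 (n%:R : R) by apply: lt_le_trans Ln; rewrite ltr0n.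
rewrite /cost [#|_|]card_announcement mulr_natl mulr2n.
have nn0 := mulr_gt0 nR nR; have nnl0 := mulr_gt0 nn0 lg0.
rewrite -!log2M //.
apply: le_log2; first by rewrite ltr0n !muln_gt0 n0.
move: (log2 n%:R) Ln lg0 => l Ln l0; rewrite !natrM -!mulrA !ler_pM2l //.
(* The constant 5 comes from [2 * (L + 1) + 1 <= 5 * L], where [L = trunc_log 2 n] is at least 1. *)
apply: (@le_trans _ _ (trunc_log 2 n * 5)%:R); first by rewrite ler_nat; lia.
by rewrite natrM ler_pM2r.
Qed.

End Cost.

Theorem theorem1 (R : realType) :
  exists K : R, forall n : nat, (3 <= n)%N ->
    (nd_complexity R (facet_vertex_fun (spanning_tree_polytope R n))
      <= (2 * log2 (n%:R : R) + log2 (log2 (n%:R : R)) + K)%:E)%E.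
Proof.
exists (log2 5) => n n3; have n2 : (1 < n)%N by apply: ltnW.
apply: (@le_trans _ _ (cost R (face_protocol R n))%:E).
  by apply: ereal_inf_lbound; exists (face_protocol R n); split=> //; apply: face_protocol_computes.
by rewrite lee_fin face_protocol_cost.
Qed.
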